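(* For every $h\in(0,\bar h]$ and every $z\in\{-1,1\}$, the mapping $y\mapsto y+\hat a_h(y)\,z$ is nondecreasing on $I$.
   Context: Let $Y=(Y_t)_{t\ge0}$ be a one-dimensional continuous strong Markov process (in the sense of Revuz--Yor, Section VII.3) with laws $(P_y)_{y\in I}$, $P_y[Y_0=y]=1$. Its state space $I\subseteq\mathbb R$ is an open, half-open or closed interval with interior $I^\circ=(l,r)$, $-\infty\le l<r\le\infty$; put $\bar I=[l,r]$. Let $H_x(Y)=\inf\{t\ge0:Y_t=x\}$. Standing assumptions: $Y$ is regular ($P_y[H_x(Y)<\infty]>0$ for all $y\in I^\circ$, $x\in I$), conservative (infinite life time) and in natural scale. Let $m$ be the speed measure of $Y$ on $I^\circ$ (normalized so that Brownian motion has $m(dx)=2\,dx$); recall that $0<m([a,b])<\infty$ for all $a<b$ in $I^\circ$. A boundary point $b\in\{l,r\}$ is called accessible if $P_y[H_b(Y)<\infty]>0$ for some (equivalently all) $y\in I^\circ$; $b$ is accessible if and only if $b\in I$, and accessible boundary points are assumed absorbing. By Feller's test, $l\in I$ if and only if $l>-\infty$ and $\int_{(l,y)}(u-l)\,m(du)<\infty$ for some (equivalently all) $y\in I^\circ$, and symmetrically for $r$. Fix $\bar h\in(0,\infty)$. For $h\in(0,\bar h]$ the EMCEL scale factor $\hat a_h\colon\bar I\to[0,\infty)$ is defined by $\hat a_h(l)=\hat a_h(r)=0$ and, for $y\in I^\circ$, $$\hat a_h(y)=\sup\Big\{a\ge0:\ y\pm a\in I\ \text{ and }\ \tfrac12\int_{(y-a,y+a)}(a-|u-y|)\,m(du)\le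 h\Big\}.$$ *)

(* Defs.v *)
From HB Require Import structures.
From mathcomp Require Import all_boot all_order all_algebra.
From mathcomp Require Import all_classical all_reals all_analysis.
From mathcomp Require Import measurable_realfun.

Set Implicit Arguments.
Unset Strict Implicit.
Unset Printing Implicit Defensive.

Import Order.TTheory GRing.Theory Num.Theory.
Import numFieldNormedType.Exports.

Local Open Scope classical_set_scope.
Local Open Scope ring_scope.

Section StateSpace.
Context {R : realType}.
Implicit Types (l r : \bar R) (I : set R).

Definition interior_pt l r : set R := [set y | (l < y%:E < r)%E].

(* I is an open, half-open or closed interval with interior ]l, r[; whether a
   finite endpoint belongs to I is left free. *)
Definition is_state_space l r I : Prop :=
  [/\ (l < r)%E, interior_pt l r `<=` I & I `<=` [set y | (l <= y%:E <= r)%E]].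

End StateSpace.

(* Time is R, but only the times t >= 0 are used. *)
Section Process.
Context {R : realType} d (Omega : measurableType d).
Variable Y : R -> Omega -> R.

(* +oo if x is never visited *)
Definition hitting_time (x : R) (w : Omega) : \bar R :=
  ereal_inf [set t%:E | t in [set t | 0 <= t /\ Y t w = x]].

Definition natural_filtration (t : R) : set (set Omega) :=
  <<s [set A | exists (s : R) (B : set R),
         [/\ 0 <= s <= t, measurable B & A = Y s @^-1` B] ]>>.

Definition right_filtration (t : R) : set (set Omega) :=
  [set A | forall s : R, t < s -> natural_filtration s A].

Definition stopping_time (tau : Omega -> \bar R) : Prop :=
  (forall w, (0 <= tau w)%E) /\
  (forall t : R, 0 <= t -> right_filtration t [set w | (tau w <= t%:E)%E]).

(* This constrains A on {tau < +oo} only. *)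
Definition in_past (tau : Omega -> \bar R) (A : set Omega) : Prop :=
  forall t : R, 0 <= t -> right_filtration t (A `&` [set w | (tau w <= t%:E)%E]).

(* P y is the law of the process started in y; only y in I matters. As every
   path stays in I at all times, the life time is infinite. *)
Record continuous_strong_markov (I : set R) (P : R -> probability Omega R)
    : Prop := ContinuousStrongMarkov {
  csm_state : forall (t : R) w, 0 <= t -> I (Y t w) ;
  csm_path : forall w, {within `[0, +oo[, continuous (fun t => Y t w)} ;
  csm_meas : forall t : R, 0 <= t -> measurable_fun setT (Y t) ;
  csm_start : forall y, I y -> P y [set w | Y 0 w = y] = 1%E ;
  csm_kernel : forall (t : R) (B : set R), 0 <= t -> measurable B ->
    measurable_fun I (fun y : R => P y (Y t @^-1` B)) ;
  (* As tau + s is again a stopping time, the one-time version below yields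
     the strong Markov property for functionals of the whole future. *)
  csm_strong_markov : forall y tau A (t : R) (B : set R),
    I y -> stopping_time tau -> in_past tau A -> 0 <= t -> measurable B ->
    P y (A `&` [set w | (tau w < +oo)%E /\ B (Y (fine (tau w) + t) w)]) =
    (\int[P y]_(w in A `&` [set w | (tau w < +oo)%E])
       P (Y (fine (tau w)) w) (Y t @^-1` B))%E }.

Definition regular (l r : \bar R) (I : set R) (P : R -> probability Omega R) :=
  forall y x, interior_pt l r y -> I x ->
    (0 < P y [set w | (hitting_time x w < +oo)%E])%E.

Definition absorbing_boundary (l r : \bar R) (I : set R)
    (P : R -> probability Omega R) :=
  forall b, I b -> b%:E = l \/ b%:E = r ->
    P b [set w | forall t : R, 0 <= t -> Y t w = b] = 1%E.

Definition natural_scale (I : set R) (P : R -> probability Omega R) :=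
  forall a b y, I a -> I b -> a < y < b ->
    P y [set w | (hitting_time b w < hitting_time a w)%E] =
    ((y - a) / (b - a))%:E.

(* Green function of ]a, b[ in natural scale *)
Definition green (a b y u : R) : R :=
  (Num.min y u - a) * (b - Num.max y u) / (b - a).

(* Speed measure in the sense of Revuz-Yor, Theorem VII.3.6: the Radon measure
   on ]l, r[ representing the mean exit times. For Brownian motion it is 2 dx.
   Only the restriction of m to ]l, r[ is constrained, or ever used. *)
Definition speed_measure (l r : \bar R) (I : set R)
    (P : R -> probability Omega R)
    (m : {measure set (measurableTypeR R) -> \bar R}) : Prop :=
  (forall a b, interior_pt l r a -> interior_pt l r b ->
     (m `[a, b]%classic < +oo)%E) /\
  (forall a b y, I a -> I b -> a < y < b ->
     (\int[P y]_w Order.min (hitting_time a w) (hitting_time b w) =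
      \int[m]_(u in `]a, b[%classic) (green a b y u)%:E)%E).

End Process.

Section Emcel.
Context {R : realType}.

Definition emcel_set (I : set R)
    (m : {measure set (measurableTypeR R) -> \bar R}) (h y : R) : set R :=
  [set a : R | [/\ 0 <= a, I (y - a), I (y + a) &
    (2^-1%:E * \int[m]_(u in `](y - a)%R, (y + a)%R[%classic) (a - `|u - y|)%R%:E
       <= h%:E)%E] ].

(* The scale factor on [l, r], including infinite endpoints. *)
Definition emcel (l r : \bar R) (I : set R)
    (m : {measure set (measurableTypeR R) -> \bar R}) (h : R) (y : \bar R) : R :=
  if (l < y < r)%E then sup (emcel_set I m h (fine y)) else 0%R.

End Emcel.

(* Main.v *)
(* If |y' - y| <= a, shrinking the radius from a to a' = a - |y' - y| while moving
   the centre from y to y' shrinks both the interval and, by the triangle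
   inequality, the tent a - |u - y|. Hence a' is admissible at y' whenever a is
   admissible at y, so the scale factor is 1-Lipschitz, which is the claim for
   both signs of z. As sup is 0 on an unbounded set, the admissible sets must be
   shown to be bounded: they are as soon as m charges a neighbourhood of y, and
   it does because a continuous path started at y has a positive mean exit time
   from the neighbourhood, which is the m-integral of the Green function. *)
Require Import Defs.
From HB Require Import structures.
From mathcomp Require Import all_boot all_order all_algebra.
From mathcomp Require Import all_classical all_reals all_analysis.
From mathcomp Require Import measurable_realfun.
From mathcomp Require Import lra.
Set Implicit Arguments.
Unset Strict Implicit.
Unset Printing Implicit Defensive.
Import Order.TTheory GRing.Theory Num.Theory.
Import numFieldNormedType.Exports.
Local Open Scope classical_set_scope.
Local Open Scope ring_scope.

(** The integral of a nonnegative function is a supremum over the simple functions below it, which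
    grows with the function, measurable or not. This allows bounding the mean of a minimum of
    hitting times from below. *)
Lemma le_integralT_nonmeasurable (d : measure_display) (T : measurableType d)
    (R : realType) (mu : {measure set T -> \bar R}) (f g : T -> \bar R) :
  (forall x, (0 <= f x)%E) -> (forall x, (f x <= g x)%E) ->
  (\int[mu]_x f x <= \int[mu]_x g x)%E.
Proof.
move=> f0 fg; have g0 x : (0 <= g x)%E by exact: le_trans (f0 x) (fg x).
rewrite !ge0_integralTE//; apply: le_ereal_sup => _ [k kf <-].
by exists k => // x; exact: le_trans (kf x) (fg x).
Qed.

(** * Path continuity and positivity of the mean exit time *)

Section Paths.
Context {R : realType} {d : measure_display} {Omega : measurableType d}.
Variables (Y : R -> Omega -> R) (I : set R) (P : R -> probability Omega R).
Hypothesis csm : continuous_strong_markov Y I P.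

Lemma path_near (w : Omega) (s e : R) : 0 <= s -> 0 < e ->
  exists2 del : R, 0 < del &
    forall t : R, 0 <= t -> `|t - s| < del -> `|Y t w - Y s w| < e.
Proof.
move=> s0 e0; have /subspace_continuousP/(_ s) := @csm_path _ _ _ _ _ _ csm w.
rewrite /= in_itv/= andbT => /(_ s0)/cvgrPdist_lt/(_ _ e0).
rewrite near_withinE /= => -[del del0 H]; exists del => //= t t0 ts.
rewrite distrC; apply: H; last by rewrite /= in_itv/= andbT.
by rewrite /= distrC.
Qed.

(* Restricting to rational times makes the event measurable; continuity recovers
   the real times, at the price of the larger radius in [stays_near_time]. *)
Definition stays_near (y : R) (n : nat) : set Omega :=
  \bigcap_(q in [set q : rat | 0 <= (ratr q : R) <= n.+1%:R^-1])
    [set w | `|Y (ratr q) w - y| < 2^-1].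

Lemma measurable_stays_near y n : measurable (stays_near y n).
Proof.
rewrite -[stays_near y n]setCK; apply: measurableC.
rewrite /stays_near setC_bigcap bigcup_mkcond.
apply: bigcupT_measurable_rat => q.
case: ifPn => [/set_mem/= /andP[q0 _]|_]; last exact: measurable0.
apply: measurableC.
have -> : [set w | `|Y (ratr q) w - y| < 2^-1] =
    Y (ratr q) @^-1` ball y 2^-1.
  by apply/seteqP; split => w /=; rewrite /ball/= distrC.
rewrite -[X in measurable X]setTI; apply: (csm_meas csm q0) => //.
exact: measurable_ball.
Qed.

(** Continuity at time 0 keeps the path within 1/2 of its start on some initial time interval. *)
Lemma start_sub_stays_near y :
  [set w | Y 0 w = y] `<=` \bigcup_n stays_near y n.
Proof.
move=> w /= Yw; have half0 : (0 : R) < 2^-1 by rewrite invr_gt0.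
have [del del0 H] := path_near w (lexx 0) half0.
have [n _ /(_ n (leqnn n)) /= ndel] := near_infty_natSinv_lt (PosNum del0).
exists n => // q /= /andP[q0 qn]; rewrite -Yw; apply: H => //.
by rewrite subr0 ger0_norm//; exact: le_lt_trans qn ndel.
Qed.

Lemma stays_near_time y n s w : stays_near y n w -> 0 <= s <= n.+1%:R^-1 ->
  `|Y s w - y| < 1.
Proof.
move=> Ew /andP[s0 sn]; have half0 : (0 : R) < 2^-1 by rewrite invr_gt0.
have [q /andP[q0 qn] qs] : exists2 q : rat, 0 <= (ratr q : R) <= n.+1%:R^-1 &
    `|Y s w - Y (ratr q) w| < 2^-1.
  have [del del0 H] := path_near w s0 half0.
  move: s0; rewrite le_eqVlt => /predU1P[s0|s0].
    exists 0; first by rewrite rmorph0 lexx/= invr_ge0.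
    by rewrite rmorph0 s0 subrr normr0.
  (* The rational time is taken to the left of [s], so that it stays below the time bound; this is
     why [s = 0] is treated apart. *)
  have : Num.max 0 (s - del) < s by rewrite gt_max s0 gtrBl.
  move=> /rat_in_itvoo[q]; rewrite in_itv/= gt_max => /andP[/andP[q0 qd] qs].
  exists q; first by rewrite (ltW q0) (le_trans (ltW qs)).
  rewrite distrC; apply: H; first exact: ltW.
  by rewrite ltr0_norm; lra.
have := Ew q; rewrite /= q0 qn => /(_ isT) qy.
have := ler_distD (Y (ratr q) w) (Y s w) y; lra.
Qed.

Lemma stays_near_hitting y n x w : 1 <= `|x - y| -> stays_near y n w ->
  (n.+1%:R^-1%:E <= hitting_time Y x w)%E.
Proof.
move=> xy Ew; apply: le_ereal_inf_tmp => _ [s [s0 Ys] <-].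
rewrite lee_fin leNgt; apply/negP => sn.
have := @stays_near_time y n s w Ew; rewrite s0 (ltW sn) Ys => /(_ isT).
by rewrite ltNge xy.
Qed.

(** On [stays_near y n] the exit time is at least 1/(n+1), so a vanishing mean makes all these
    events null. Their union would then be null, although it contains the start event, which has
    probability 1. *)
Lemma exit_time_mean_gt0 y : I y ->
  (0 < \int[P y]_w Order.min (hitting_time Y (y - 1) w)
                             (hitting_time Y (y + 1) w))%E.
Proof.
move=> Iy.
have ht0 x w : (0 <= hitting_time Y x w)%E.
  by apply: le_ereal_inf_tmp => _ [s [s0 _] <-]; rewrite lee_fin.
have m0 w : (0 <= Order.min (hitting_time Y (y - 1) w)
                            (hitting_time Y (y + 1) w))%E.
  by rewrite le_min !ht0.
have mean n : (n.+1%:R^-1%:E * P y (stays_near y n) <=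
    \int[P y]_w Order.min (hitting_time Y (y - 1) w)
                          (hitting_time Y (y + 1) w))%E.
  have mE := measurable_stays_near y n.
  have c0 : (0 : R) <= n.+1%:R^-1 by rewrite invr_ge0.
  rewrite -(setIT (stays_near y n)) -integral_indic// -ge0_integralZl//; last first.
    by apply/measurable_EFinP; exact: measurable_indic.
  apply: le_integralT_nonmeasurable => w.
    by rewrite -EFinM lee_fin mulr_ge0.
  rewrite indicE; have [/set_mem wE|_] := boolP (w \in _); last first.
    by rewrite mule0.
  rewrite mule1 le_min !(@stays_near_hitting y)//.
  + by rewrite addrAC subrr add0r normr1.
  + by rewrite addrAC subrr add0r normrN1.
rewrite lt_neqAle integral_ge0// andbT; apply/negP => /eqP z.
suff : (P y).-negligible (\bigcup_n stays_near y n).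
  move=> /negligibleS-/(_ _ (@start_sub_stays_near y)) N.
  have : P y [set w | Y 0 w = y] = 0%E.
    apply/negligibleP => //.
    have -> : [set w | Y 0 w = y] = Y 0 @^-1` [set y] by [].
    rewrite -[X in measurable X]setTI.
    by apply: (csm_meas csm (lexx 0)).
  by rewrite (csm_start csm Iy) => /eqP; rewrite onee_eq0.
apply: negligible_bigcup => n.
apply/negligibleP; first exact: measurable_stays_near.
have := mean n; rewrite -z => /(conj (measure_ge0 (P y) (stays_near y n))) [p0 p].
apply/eqP; rewrite eq_le p0 andbT leNgt; apply/negP => pp.
move: p; rewrite leNgt => /negP; apply.
by rewrite mule_gt0// lte_fin invr_gt0.
Qed.

End Paths.

(** * Admissible radii: shift of the centre, boundedness, Lipschitz bound *)

Section Emcel_set.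
Context {R : realType}.
Variables (I : set R) (m : {measure set (measurableTypeR R) -> \bar R}).

Lemma measurable_tent (D : set R) (a y : R) :
  measurable_fun D (fun u : measurableTypeR R => (a - `|u - y|)%R%:E).
Proof.
apply/measurable_EFinP; apply: measurable_funB => //.
apply: measurableT_comp => //.
exact: measurable_funB.
Qed.

Lemma tent_ge0 (a y u : R) : `](y - a)%R, (y + a)%R[%classic u -> 
  (0 <= (a - `|u - y|)%R%:E)%E.
Proof.
rewrite /= in_itv/= lee_fin subr_ge0 => /andP[h1 h2].
by rewrite ler_norml; apply/andP; split; lra.
Qed.

Lemma le_tent_integral (a a' y y' : R) : `|y' - y| <= a - a' ->
  (\int[m]_(u in `](y' - a')%R, (y' + a')%R[%classic) (a' - `|u - y'|)%R%:E <=
   \int[m]_(u in `](y - a)%R, (y + a)%R[%classic) (a - `|u - y|)%R%:E)%E.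
Proof.
move=> aa'; have aa'2 := aa'; move: aa'2; rewrite ler_norml => /andP[l1 l2].
have sub : `](y' - a')%R, (y' + a')%R[%classic `<=` `](y - a)%R, (y + a)%R[%classic.
  move=> u; rewrite /= !in_itv/= => /andP[u1 u2]; apply/andP; split; lra.
(* The integrand is enlarged first on the small interval; the domain can then be enlarged because
   the larger tent is nonnegative on the larger interval. *)
apply: (@le_trans _ _
    (\int[m]_(u in `](y' - a')%R, (y' + a')%R[%classic) (a - `|u - y|)%R%:E)%E).
  apply: ge0_le_integral.
  - exact: measurable_itv.
  - exact: tent_ge0.
  - exact: measurable_tent.
  - exact: measurable_tent.
  - move=> u _; rewrite lee_fin.
    have := ler_distD y' u y; lra.
apply: ge0_subset_integral => //.
- exact: measurable_tent.
- exact: tent_ge0.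
Qed.

Lemma emcel_set0 h y : 0 <= h -> I y -> emcel_set I m h y 0.
Proof.
move=> h0 Iy; rewrite /emcel_set /= subr0 addr0; split => //.
by rewrite set_itvoo0 integral_set0 mule0 lee_fin.
Qed.

Lemma emcel_set_shift h y y' a : is_interval I -> I y' ->
  `|y' - y| <= a -> emcel_set I m h y a ->
  emcel_set I m h y' (a - `|y' - y|).
Proof.
move=> Iitv Iy' ya [a0 Il Ir Gh].
have ha : `|y' - y| <= a - (a - `|y' - y|) by rewrite subKr.
move: (ha); rewrite subKr ler_norml => /andP[h1 h2].
split.
- by rewrite subr_ge0.
(* Each new endpoint lies between an old endpoint and [y']. *)
- apply: (Iitv (y - a) y') => //; apply/andP; split; lra.
- apply: (Iitv y' (y + a)) => //; apply/andP; split; lra.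
- apply: le_trans Gh; apply: lee_wpmul2l; first by rewrite lee_fin invr_ge0.
  exact: le_tent_integral.
Qed.

Lemma ubound_emcel_set h y : is_interval I ->
  (I (y - 2) -> I (y + 2) -> (0 < m `](y - 1)%R, (y + 1)%R[%classic < +oo)%E) ->
  has_ubound (emcel_set I m h y).
Proof.
move=> Iitv mass; set K := fine (m `](y - 1)%R, (y + 1)%R[%classic).
(* A radius [a > 2] puts [y - 2] and [y + 2] in [I], so that [K] is a genuine positive mass. On the
   unit neighbourhood the tent is at least [a - 1], whence [(a - 1) * K / 2 <= h]. Otherwise the
   bound 2 applies, whatever the value of [K]. *)
exists (Num.max 2 (1 + 2 * h / K)) => a [a0 Il Ir Gh].
rewrite le_max; have [//|a2/=] := leP a 2.
have Iy : I y by apply: (Iitv (y - a) (y + a)) => //; apply/andP; split; lra.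
have {}mass : (0 < m `](y - 1)%R, (y + 1)%R[%classic < +oo)%E.
  apply: mass.
  - by apply: (Iitv (y - a) y) => //; apply/andP; split; lra.
  - by apply: (Iitv y (y + a)) => //; apply/andP; split; lra.
have K0 : 0 < K by exact: fine_gt0.
have mK : m `](y - 1)%R, (y + 1)%R[%classic = K%:E.
  by rewrite fineK// gt0_fin_numE; case/andP: mass.
have : ((a - 1)%:E * K%:E <=
    \int[m]_(u in `](y - a)%R, (y + a)%R[%classic) (a - `|u - y|)%R%:E)%E.
  rewrite -mK -integral_cst; last exact: measurable_itv.
  apply: (@le_trans _ _ 
    (\int[m]_(u in `](y - 1)%R, (y + 1)%R[%classic) (a - `|u - y|)%R%:E)%E).
    apply: ge0_le_integral.
    - exact: measurable_itv.
    - by move=> u _; rewrite lee_fin; lra.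
    - exact: measurable_cst.
    - exact: measurable_tent.
    - move=> u; rewrite /= in_itv/= lee_fin => /andP[u1 u2].
      rewrite lerD2l lerN2 ler_norml; apply/andP; split; lra.
  apply: ge0_subset_integral => //.
  - exact: measurable_tent.
  - exact: tent_ge0.
  - by move=> u; rewrite /= !in_itv/= => /andP[u1 u2]; apply/andP; split; lra.
move=> /(@lee_wpmul2l _ 2^-1%:E); rewrite lee_fin invr_ge0 => /(_ (ler0n _ _)).
move=> /le_trans/(_ Gh); rewrite -!EFinM lee_fin => aK.
rewrite -lerBlDl ler_pdivlMr//; lra.
Qed.

Lemma sup_emcel_set_shift h y y' : 0 <= h -> is_interval I -> I y -> I y' ->
  has_ubound (emcel_set I m h y') ->
  sup (emcel_set I m h y) <= sup (emcel_set I m h y') + `|y' - y|.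
Proof.
move=> h0 Iitv Iy Iy' ub'; apply: ge_sup.
  by exists 0; exact: emcel_set0.
move=> a Aa; have [ya|ya] := leP `|y' - y| a.
  by rewrite -lerBlDr; apply: ub_le_sup => //; exact: emcel_set_shift.
(* A radius below the distance cannot be shifted; the radius 0 at [y'] is enough there. *)
apply: le_trans (ltW ya) _; rewrite lerDr.
by apply: ub_le_sup => //; exact: emcel_set0.
Qed.

(* At a boundary point of I the only admissible radius is 0, so the case
   distinction in [emcel] is immaterial on I. *)
Lemma emcelE l r h y : is_state_space l r I -> 0 <= h -> I y ->
  emcel l r I m h y%:E = sup (emcel_set I m h y).
Proof.
move=> [lr _ Ilr] h0 Iy; rewrite /emcel/=.
case: ifPn => // /nandP bd; rewrite [X in sup X](_ : _ = [set 0]) ?sup1//.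
apply/seteqP; split => [a [a0 Il Ir _]|_ ->]; last exact: emcel_set0.
apply/eqP; rewrite eq_le a0 andbT.
have /= /andP[l1 r1] := Ilr _ Il; have /= /andP[l2 r2] := Ilr _ Ir.
case: bd; rewrite -leNgt => yb.
  by have := le_trans yb l1; rewrite lee_fin; lra.
by have := le_trans r2 yb; rewrite lee_fin; lra.
Qed.

End Emcel_set.

(** * The mass of the speed measure and the conclusion *)

Lemma state_space_interval (R : realType) (l r : \bar R) (I : set R) :
  is_state_space l r I -> is_interval I.
Proof.
move=> [_ IlrI Ilr] x z Ix Iz y /andP[xy yz].
have /= /andP[lx _] := Ilr _ Ix; have /= /andP[_ zr] := Ilr _ Iz.
(* Only a point strictly between [x] and [z] is certain to be interior; the equality cases may be
   endpoints of [I]. *)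
move: xy; rewrite le_eqVlt => /predU1P[<-//|xy].
move: yz; rewrite le_eqVlt => /predU1P[->//|yz].
apply: IlrI; rewrite /interior_pt/=.
by rewrite (le_lt_trans lx) ?lte_fin// (lt_le_trans _ zr) ?lte_fin.
Qed.

Lemma speed_measure_mass (R : realType) (l r : \bar R) (I : set R)
    (d : measure_display) (Omega : measurableType d)
    (Y : R -> Omega -> R) (P : R -> probability Omega R)
    (m : {measure set (measurableTypeR R) -> \bar R}) (y : R) :
  is_state_space l r I -> continuous_strong_markov Y I P ->
  speed_measure Y l r I P m -> I (y - 2) -> I (y + 2) ->
  (0 < m `](y - 1)%R, (y + 1)%R[%classic < +oo)%E.
Proof.
move=> ss csm [mfin mean] Il Ir.
have Iitv := state_space_interval ss; have [_ _ Ilr] := ss.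
(* The margin between radii 1 and 2 places [y - 1] and [y + 1] in the interior, where [m] is finite
   on compact intervals. *)
have inner x : y - 2 < x < y + 2 -> interior_pt l r x /\ I x.
  move=> /andP[x1 x2]; split; last first.
    by apply: (Iitv _ _ Il Ir); rewrite !ltW.
  have /= /andP[ll _] := Ilr _ Il; have /= /andP[_ rr] := Ilr _ Ir.
  rewrite /interior_pt/=.
  by rewrite (le_lt_trans ll) ?lte_fin// (lt_le_trans _ rr) ?lte_fin.
have [|intl I1l] := inner (y - 1); first by apply/andP; split; lra.
have [|intr I1r] := inner (y + 1); first by apply/andP; split; lra.
have [|_ Iy] := inner y; first by apply/andP; split; lra.
apply/andP; split; last first.
  apply: le_lt_trans (mfin _ _ intl intr); apply: le_measure.
  - by rewrite inE; exact: measurable_itv.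
  - by rewrite inE; exact: measurable_itv.
  - exact: subset_itv_oo_cc.
rewrite lt_neqAle measure_ge0 andbT; apply/negP => /eqP /esym m0.
have := exit_time_mean_gt0 csm Iy.
rewrite (mean _ _ _ I1l I1r); last by apply/andP; split; lra.
(* Over an [m]-null interval the Green integral vanishes, against the positive mean exit time. *)
rewrite null_set_integral ?ltxx//.
apply/measurable_EFinP; apply: measurable_funM; last exact: measurable_cst.
apply: measurable_funM; apply: measurable_funB => //.
- exact: measurable_minr.
- exact: measurable_maxr.
Qed.

Theorem theorem2p9 (R : realType) (l r : \bar R) (I : set R)
    (d : measure_display) (Omega : measurableType d)
    (Y : R -> Omega -> R) (P : R -> probability Omega R)
    (m : {measure set (measurableTypeR R) -> \bar R}) (hbar : R) :
  is_state_space l r I ->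
  continuous_strong_markov Y I P ->
  regular Y l r I P ->
  natural_scale Y I P ->
  absorbing_boundary Y l r I P ->
  speed_measure Y l r I P m ->
  0 < hbar ->
  forall h : R, 0 < h <= hbar ->
  forall z : R, z = -1 \/ z = 1 ->
  forall y y' : R, I y -> I y' -> y <= y' ->
    y + emcel l r I m h y%:E * z <= y' + emcel l r I m h y'%:E * z.
Proof.
move=> ss csm _ _ _ sm hbar0 h /andP[h0 _] z z1 y y' Iy Iy' yy'.
have Iitv := state_space_interval ss.
have ub x : has_ubound (emcel_set I m h x).
  by apply: ubound_emcel_set => // Il Ir; exact: (speed_measure_mass ss csm sm Il Ir).
rewrite !(emcelE m ss (ltW h0))//.
(* This bound gives the case [z = 1], the reverse one below it the case [z = -1]. *)
have := sup_emcel_set_shift (ltW h0) Iitv Iy Iy' (ub y').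
have := sup_emcel_set_shift (ltW h0) Iitv Iy' Iy (ub y).
rewrite (distrC y y') ger0_norm ?subr_ge0//.
by case: z1 => ->; lra.
Qed.
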